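(* Let $V=\mathbb C^n$, and let $f_H$ be the potential on the orbit $\mathcal O(v_0\otimes\varepsilon_0)\subset V\otimes V^*$ associated to a regular element $H$ of the Cartan subalgebra. The rational function on $V\otimes V^*$ that coincides with the potential $f_H$ on $\mathcal O(v_0\otimes\varepsilon_0)$ is given by $$R_H(A)=\frac{\mathrm{tr}\left(A\rho_\mu(H)\right)}{\mathrm{tr}(A)}$$ for $A\in V\otimes V^*=\mathrm{End}(V)$.
   Context: The Cartan subalgebra is that of diagonal matrices in $\mathfrak{sl}(n,\mathbb C)$. Here $\rho_\mu$ denotes the standard representation of $SL(n,\mathbb C)$ (and of $\mathfrak{sl}(n,\mathbb C)$) on $V=\mathbb C^n$; $v_0=e_1\in V$ is the highest weight vector and $\varepsilon_0=\varepsilon_1\in V^*$ is the dual vector, so $\varepsilon_0(v_0)=1$. The group acts by $g\cdot(v\otimes\varepsilon)=\rho_\mu(g)v\otimes\varepsilon\circ\rho_\mu(g^{-1})$, and $\mathcal O(v_0\otimes\varepsilon_0)=\{g\cdot(v_0\otimes\varepsilon_0): g\in SL(n,\mathbb C)\}$. The tensor $v\otimes\varepsilon$ is identified with the endomorphism $u\mapsto\varepsilon(u)v$. The orbit $\mathcal O(v_0\otimes\varepsilon_0)$ is identified with the adjoint orbit of $H_0=\mathrm{Diag}(n-1,-1,\dots,-1)$ in $\mathfrak{sl}(n,\mathbb C)$, on which the potential is the height function $X\mapsto\langle X,H\rangle$, with $\langle\cdot,\cdot\rangle$ the Cartan–Killing form. On $\mathcal O(v_0\otimes\varepsilon_0)$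 the potential is written (up to a constant multiple) as $f_H(v\otimes\varepsilon)=\varepsilon(\rho_\mu(H)v)=\mathrm{tr}\left((v\otimes\varepsilon)\rho_\mu(H)\right)$. *)

(* Defs.v *)
From HB Require Import structures.
From mathcomp Require Import all_boot all_order all_algebra.
From mathcomp Require Import fraction complex mpoly.
From mathcomp Require Import reals.

Set Implicit Arguments.
Unset Strict Implicit.
Unset Printing Implicit Defensive.

Import Order.TTheory GRing.Theory Num.Theory.
Local Open Scope ring_scope.

Section Definitions.
Variables (R : realType) (n : nat).
Local Notation C := (R[i]).

(* V = C^n is the space of column vectors, V^* that of row vectors, and
   V (x) V^* = End(V) that of square matrices; rho_mu g is the matrix g. *)
Definition tensor (v : 'cV[C]_n) (eps : 'rV[C]_n) : 'M[C]_n := v *m eps.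

Definition pairing (eps : 'rV[C]_n) (v : 'cV[C]_n) : C := (eps *m v) 0 0.

Definition v0 : 'cV[C]_n := \col_i (val i == 0%N)%:R.
Definition eps0 : 'rV[C]_n := \row_i (val i == 0%N)%:R.

Definition orbit (A : 'M[C]_n) : Prop :=
  exists2 g : 'M[C]_n, \det g = 1 & A = tensor (g *m v0) (eps0 *m invmx g).

(* The Cartan subalgebra of sl(n, C). *)
Definition cartan (H : 'M[C]_n) : Prop := is_diag_mx H /\ \tr H = 0.

(* No root H |-> H i i - H j j (i != j) vanishes at H. *)
Definition regular (H : 'M[C]_n) : Prop :=
  forall i j, i != j -> H i i - H j j != 0.

(* f_H at the tensor v (x) eps, normalized as eps (rho_mu(H) v); it depends
   only on the tensor, being \tr (tensor v eps *m H). *)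
Definition potential (H : 'M[C]_n) (v : 'cV[C]_n) (eps : 'rV[C]_n) : C :=
  pairing eps (H *m v).

(* Rational functions on End(V): the matrix entry (i, j) is
   the coordinate numbered [mxvec_index i j]. *)
Definition ratfun := {fraction {mpoly C[n * n]}}.

Definition poly_eval (p : {mpoly C[n * n]}) (A : 'M[C]_n) : C :=
  p.@[fun k => mxvec A 0 k].

(* F is regular at A, with value z there. *)
Definition has_value (F : ratfun) (A : 'M[C]_n) (z : C) : Prop :=
  exists p q : {mpoly C[n * n]},
    [/\ F = tofrac p / tofrac q, poly_eval q A != 0
      & z = poly_eval p A / poly_eval q A].

(* Homogeneous of degree 0, i.e. a rational function on P(End(V)). *)
Definition homogeneous0 (F : ratfun) : Prop :=
  exists (d : nat) (p q : {mpoly C[n * n]}),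
    [/\ p \is d.-homog, q \is d.-homog, q != 0 & F = tofrac p / tofrac q].

Definition coincides_on_orbit (F : ratfun) (H : 'M[C]_n) : Prop :=
  forall v eps, orbit (tensor v eps) ->
    has_value F (tensor v eps) (potential H v eps).

Definition generic_mx : 'M[{mpoly C[n * n]}]_n :=
  \matrix_(i, j) 'X_(mxvec_index i j).

(* tr(A rho_mu(H)) / tr(A) in the function field, A being the generic matrix. *)
Definition R_H (H : 'M[C]_n) : ratfun :=
  tofrac (\tr (generic_mx *m map_mx (@mpolyC (n * n) C) H))
  / tofrac (\tr generic_mx).

End Definitions.

(* Main.v *)
Require Import Defs.
From mathcomp Require Import all_boot all_order all_algebra.
From mathcomp Require Import fraction complex mpoly reals.
Import GRing.Theory Num.Theory.
Local Open Scope ring_scope.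

Set Implicit Arguments.
Unset Strict Implicit.
Unset Printing Implicit Defensive.

(** A tensor v (x) eps of trace eps v = 1 lies on the orbit: some g in GL(n)
    carries (v0, eps0) to (v, eps), and rescaling g to determinant 1 does not
    change g v0 (x) eps0 g^-1. So a rational function agreeing with f_H on the
    orbit is determined at a rank-one tensor A of trace t != 0 through its value
    at A / t: being homogeneous of degree 0, it is unchanged, as an element of
    the function field, by the substitution A |-> A / t. *)

Section Scaling.
Variables (K : idomainType) (N : nat).

Definition scale_vars (s : K) : N.-tuple {mpoly K[N]} :=
  [tuple s *: 'X_k | k < N].

Lemma meval_scale_vars (s : K) (p : {mpoly K[N]}) (x : 'I_N -> K) :
  (p \mPo scale_vars s).@[x] = p.@[fun k => s * x k].
Proof.
rewrite comp_mpoly_meval; apply: meval_eq => k.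
by rewrite tnth_mktuple mevalZ mevalXU.
Qed.

(** Every monomial in the support has degree [d], so each picks up the same factor [s ^+ d]. *)
Lemma dhomog_scale_vars (s : K) (d : nat) (p : {mpoly K[N]}) :
  p \is d.-homog -> p \mPo scale_vars s = s ^+ d *: p.
Proof.
move=> /dhomogP hp; rewrite comp_mpolyE [in RHS](mpolyE p) scaler_sumr.
apply: eq_big_seq => m /hp dm.
rewrite scalerA mulrC -scalerA; congr (_ *: _).
under eq_bigr do rewrite tnth_mktuple exprZn.
by rewrite scaler_prod -mpolyXE_id prodrXr -mdegE dm.
Qed.

Lemma frac_eq (p q p' q' : {mpoly K[N]}) : q != 0 -> q' != 0 ->
  (tofrac p / tofrac q == tofrac p' / tofrac q') = (p * q' == p' * q).
Proof.
move=> q0 q'0.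
by rewrite GRing.eqr_div ?tofrac_eq0 // -!tofracM tofrac_eq.
Qed.

(** Substituting in the cross-multiplied identity [p * q' = p' * q] multiplies both [p'] and [q'] by
    [s ^+ d], which then cancels. The fraction [p / q] itself may have inhomogeneous terms. *)
Lemma homog_frac_scale_vars (s : K) (d : nat) (p q p' q' : {mpoly K[N]}) :
  s != 0 -> p' \is d.-homog -> q' \is d.-homog -> q' != 0 ->
  q != 0 -> q \mPo scale_vars s != 0 ->
  tofrac p / tofrac q = tofrac p' / tofrac q' ->
  tofrac (p \mPo scale_vars s) / tofrac (q \mPo scale_vars s)
    = tofrac p' / tofrac q'.
Proof.
move=> s0 hp' hq' q'0 q0 qs0 /eqP; rewrite frac_eq // => /eqP e.
apply/eqP; rewrite frac_eq //; apply/eqP.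
have := congr1 (comp_mpoly (scale_vars s)) e.
rewrite !rmorphM /= (dhomog_scale_vars s hp') (dhomog_scale_vars s hq').
rewrite -!mul_mpolyC mulrCA -mulrA.
by apply: mulfI; rewrite mpolyC_eq0 expf_neq0.
Qed.

End Scaling.

Arguments scale_vars {K N} s.

Section Orbit.
Variables (R : realType) (n : nat).
Local Notation C := (R[i]).
Implicit Types (A H : 'M[C]_n) (v : 'cV[C]_n) (eps : 'rV[C]_n).

Lemma tr_tensor v eps : \tr (tensor v eps) = pairing eps v.
Proof. by rewrite mxtrace_mulC trace_mx11. Qed.

Lemma tr_tensor_mul H v eps : \tr (tensor v eps *m H) = potential H v eps.
Proof. by rewrite -mulmxA mxtrace_mulC -mulmxA trace_mx11. Qed.

Lemma pairing_eps0 : (0 < n)%N -> pairing (eps0 R n) (v0 R n) = 1.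
Proof.
move=> n_gt0; rewrite /pairing mxE (bigD1 (Ordinal n_gt0)) //= !mxE !mulr1.
rewrite big1 ?addr0 // => i i0; rewrite !mxE -val_eqE /= in i0 *.
by rewrite (negPf i0) mul0r.
Qed.

Lemma orbit_tr A : (0 < n)%N -> Defs.orbit A -> \tr A = 1.
Proof.
move=> n_gt0 [g dg ->].
have gu : g \in unitmx by rewrite unitmxE dg unitr1.
by rewrite tr_tensor /pairing mulmxA mulmxKV // -/(pairing _ _) pairing_eps0.
Qed.

(** The rank-one matrix [v0 *m v^T] sends the row [eps0] to [v^T] without lowering its rank, so
    [complete_unitmx] replaces it by an invertible matrix with the same effect on [eps0];
    transposing gives the action on columns. *)
Lemma unitmx_map_v0 v : (0 < n)%N -> v != 0 ->
  exists2 g, g \in unitmx & g *m v0 R n = v.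
Proof.
move=> n_gt0 vn0.
have ranke : \rank (eps0 R n) = 1%N.
  rewrite rank_rV; case: eqP => // e; have := pairing_eps0 n_gt0.
  by rewrite e /pairing mul0mx mxE => /eqP; rewrite eq_sym oner_eq0.
have e : eps0 R n *m (v0 R n *m v^T) = v^T.
  by rewrite mulmxA (mx11_scalar (eps0 R n *m _)) -/(pairing _ _)
             pairing_eps0 // mul1mx.
have [|g gu] := @complete_unitmx _ _ _ (eps0 R n) (v0 R n *m v^T).
  by rewrite e ranke rank_rV trmx_eq0 vn0.
rewrite e => vg; exists g^T; first by rewrite unitmx_tr.
apply: trmx_inj; rewrite trmx_mul trmxK vg; congr (_ *m _).
by apply/rowP=> i; rewrite !mxE.
Qed.

Lemma unitmx_map_v0_eps0 v eps : (0 < n)%N -> pairing eps v = 1 ->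
  exists2 g, g \in unitmx & g *m v0 R n = v /\ eps0 R n *m invmx g = eps.
Proof.
move=> n_gt0 ev.
have vn0 : v != 0.
  apply: contra_eq_neq ev => ->; rewrite /pairing mulmx0 mxE.
  by rewrite eq_sym oner_eq0.
have [g1 g1u g1v] := unitmx_map_v0 n_gt0 vn0.
(* [g1] already handles the vector; [w] is the remaining error on the covector. Both forms in the
   difference take the value 1 at [v0], so [w] kills [v0] and [v0 *m w] squares to zero. *)
pose w := eps *m g1 - eps0 R n.
have e0v0 : eps0 R n *m v0 R n = 1%:M.
  by rewrite [LHS]mx11_scalar -/(pairing _ _) pairing_eps0.
have wv0 : w *m v0 R n = 0.
  by rewrite mulmxBl -mulmxA g1v e0v0 [eps *m v]mx11_scalar -/(pairing _ _) ev
             subrr.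
(* The transvection [1 + v0 w] fixes v0 and carries eps0 to [eps *m g1]. *)
pose g2 := 1%:M + v0 R n *m w; pose g2' := 1%:M - v0 R n *m w.
have sq0 : v0 R n *m w *m (v0 R n *m w) = 0.
  by rewrite mulmxA -(mulmxA _ w) wv0 mulmx0 mul0mx.
have g22' : g2' *m g2 = 1%:M.
  by rewrite mulmxDr mulmx1 mulmxBl mul1mx sq0 subr0 subrK.
have [g2'u g2u] := mulmx1_unit g22'.
exists (g1 *m g2'); first by rewrite unitmx_mul g1u.
split.
  by rewrite -mulmxA mulmxBl mul1mx -mulmxA wv0 mulmx0 subr0.
have gg : g1 *m g2' *m (g2 *m invmx g1) = 1%:M.
  by rewrite mulmxA -(mulmxA g1) g22' mulmx1 mulmxV.
have -> : invmx (g1 *m g2') = g2 *m invmx g1.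
  have gu : g1 *m g2' \in unitmx by rewrite unitmx_mul g1u.
  by rewrite -[RHS](mulKmx gu) gg mulmx1.
by rewrite mulmxA mulmxDr mulmx1 mulmxA e0v0 mul1mx addrC subrK mulmxK.
Qed.

Lemma orbit_tensor v eps : (0 < n)%N -> pairing eps v = 1 ->
  Defs.orbit (tensor v eps).
Proof.
move=> n_gt0 /(unitmx_map_v0_eps0 n_gt0)[g gu [gv ge]].
(* Scaling by [s] multiplies the determinant by [s ^+ n], hence the inverse of an n-th root. *)
pose s : C := (n.-root%C (\det g))^-1.
have detg0 : \det g != 0 by rewrite -unitfE -unitmxE.
have sn : s ^+ n * \det g = 1 by rewrite exprVn rootCK // mulVf.
have s0 : s != 0.
  apply: contra_eq_neq sn => ->.
  by rewrite expr0n eqn0Ngt n_gt0 mul0r eq_sym oner_eq0.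
exists (s *: g); first by rewrite detZ.
rewrite invmxZ ?unitmxZ ?unitfE //.
by rewrite -scalemxAl -scalemxAr gv ge /tensor -scalemxAl -scalemxAr scalerA
           divff // scale1r.
Qed.

End Orbit.

Section RH.
Variables (R : realType) (n : nat).
Local Notation C := (R[i]).
Implicit Types (A H : 'M[C]_n).

Lemma poly_eval_tr A : poly_eval (\tr (generic_mx R n)) A = \tr A.
Proof.
rewrite /poly_eval raddf_sum; apply: eq_bigr => i _.
by rewrite mxE /= mevalXU mxvecE.
Qed.

Lemma poly_eval_tr_mul H A :
  poly_eval (\tr (generic_mx R n *m map_mx (@mpolyC (n * n) C) H)) A
    = \tr (A *m H).
Proof.
rewrite /poly_eval raddf_sum; apply: eq_bigr => i _.
rewrite !mxE raddf_sum /=; apply: eq_bigr => j _.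
by rewrite !mxE /= mevalM mevalXU mevalC mxvecE.
Qed.

Lemma R_H_value H A : \tr A != 0 ->
  has_value (R_H H) A (\tr (A *m H) / \tr A).
Proof.
by move=> trA; do 2!eexists; split; [reflexivity | |];
   rewrite ?poly_eval_tr_mul poly_eval_tr.
Qed.

(** The trace is identically 1 on the orbit, so dividing by it leaves the potential unchanged. *)
Lemma R_H_coincides H : (0 < n)%N -> coincides_on_orbit (R_H H) H.
Proof.
move=> n_gt0 v eps /(orbit_tr n_gt0) trA.
rewrite -tr_tensor_mul -[\tr (_ *m H)]divr1 -trA.
by apply: R_H_value; rewrite trA oner_neq0.
Qed.

Lemma R_H_homogeneous0 H : (0 < n)%N -> homogeneous0 (R_H H).
Proof.
move=> n_gt0; exists 1%N; do 2!eexists; split; last reflexivity.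
- apply: rpred_sum => i _; rewrite mxE; apply: rpred_sum => j _.
  by rewrite !mxE mulrC mul_mpolyC; apply: dhomogZ; rewrite dhomogX /= mdeg1.
- by apply: rpred_sum => i _; rewrite mxE dhomogX /= mdeg1.
(* The generic trace is a nonzero polynomial because it takes the value 1 at [tensor v0 eps0]. *)
- apply/eqP => e; have := poly_eval_tr (tensor (v0 R n) (eps0 R n)).
  rewrite e /poly_eval meval0 tr_tensor pairing_eps0 // => /eqP.
  by rewrite eq_sym oner_eq0.
Qed.

Lemma poly_eval_neq0 (p : {mpoly C[n * n]}) A : poly_eval p A != 0 -> p != 0.
Proof. by apply: contraNneq => ->; rewrite /poly_eval meval0. Qed.

(** The homogeneous denominator [q'] may vanish at [A]. The witness is instead the fraction [p / q]
    regular at [s *: A], with its variables scaled by [s]: it is regular at [A], and degree 0 makes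
    it represent the same [F]. *)
Lemma has_value_scale (F : ratfun R n) (s : C) A z :
  s != 0 -> homogeneous0 F -> has_value F (s *: A) z -> has_value F A z.
Proof.
move=> s0 [d [p' [q' [hp' hq' q'0 ->]]]] [p [q [e qA ->]]].
have evals (r : {mpoly C[n * n]}) :
    poly_eval (r \mPo scale_vars s) A = poly_eval r (s *: A).
  rewrite /poly_eval meval_scale_vars; apply: meval_eq => k.
  by rewrite linearZ mxE.
have q0 := poly_eval_neq0 qA.
have qs0 : q \mPo scale_vars s != 0.
  by apply: (@poly_eval_neq0 _ A); rewrite evals.
exists (p \mPo scale_vars s), (q \mPo scale_vars s).
split.
- exact/esym/(homog_frac_scale_vars s0 hp' hq' q'0 q0 qs0)/esym.
- by rewrite evals.
- by congr (_ / _); apply/esym/evals.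
Qed.

End RH.

Theorem theorem6p3 (R : realType) (n : nat) (n_gt0 : (0 < n)%N)
    (H : 'M[R[i]]_n) (H_cartan : cartan H) (H_regular : regular H) :
  (forall A : 'M[R[i]]_n, \tr A != 0 ->
     has_value (R_H H) A (\tr (A *m H) / \tr A)) /\
  coincides_on_orbit (R_H H) H /\
  homogeneous0 (R_H H) /\
  (forall F : ratfun R n, homogeneous0 F -> coincides_on_orbit F H ->
     forall (v : 'cV[R[i]]_n) (eps : 'rV[R[i]]_n),
       \tr (tensor v eps) != 0 ->
       has_value F (tensor v eps)
         (\tr (tensor v eps *m H) / \tr (tensor v eps))).
Proof.
split; first exact: R_H_value.
split; first exact: R_H_coincides.
split; first exact: R_H_homogeneous0.
move=> F homF coinF v eps trA; set t := \tr _ in trA *.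
(* Absorbing the scalar into [v] shows that the trace-one multiple is still a tensor, so it lies on
   the orbit and [coinF] gives the value there. *)
have tensorZ : tensor (t^-1 *: v) eps = t^-1 *: tensor v eps.
  by rewrite /tensor -scalemxAl.
apply: (@has_value_scale _ _ _ t^-1); rewrite ?invr_eq0 //.
rewrite -tensorZ mulrC -mxtraceZ.
rewrite [_ *: (_ *m H)]scalemxAl -tensorZ tr_tensor_mul.
apply/coinF/orbit_tensor => //.
by rewrite -tr_tensor tensorZ mxtraceZ mulVf.
Qed.
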